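(* Let $n\ge 1$. For every integer $N$ with $2n-1\leq N\leq n(n+1)/2$, there exists an exact phase-retrievable frame $\{f_i\}_{i=1}^N$ of length $N$ for $\mathbb{R}^n$.
   Context: All spaces are real. A finite sequence $\mathcal{F}=\{f_i\}_{i=1}^N$ in a finite-dimensional real inner product space $V$ is a frame for $V$ if it spans $V$. It is phase-retrievable (a PR frame) if whenever $x,y\in V$ satisfy $|\langle x,f_i\rangle|=|\langle y,f_i\rangle|$ for all $i$, then $x=\pm y$. Let $\mathrm{Sym}(V)$ be the space of self-adjoint operators on $V$, and $\mathcal{S}_2$ the set of those of rank at most $2$. For $\Lambda\subseteq\{1,\dots,N\}$ let $\mathcal{F}_\Lambda=\{f_i\}_{i\in\Lambda}$ and let $\Theta_{L(\mathcal{F}_\Lambda)}:\mathrm{Sym}(V)\to\mathbb{R}^{\Lambda}$, $A\mapsto(\langle Af_i,f_i\rangle)_{i\in\Lambda}$ (the analysis operator of $\{f_i\otimes f_i\}_{i\in\Lambda}$ for the Hilbert–Schmidt inner product). $\mathcal{F}$ has the exact PR-redundancy property if for every proper subset $\Lambda\subsetneq\{1,\dots,N\}$ one has $\ker(\Theta_{L(\mathcal{F}_\Lambda)})\cap\mathcal{S}_2\neq\ker(\Theta_{L(\mathcal{F})})\cap\mathcal{S}_2$. An exact phase-retrievable frame is a phase-retrievable frame with the exact PR-redundancy property. *)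

(* Defs.v *)
From HB Require Import structures.
From mathcomp Require Import all_boot all_order all_algebra.
From mathcomp Require Import reals.
Set Implicit Arguments. Unset Strict Implicit. Unset Printing Implicit Defensive.
Import Order.TTheory GRing.Theory Num.Theory.
Local Open Scope ring_scope.

Definition dotv (R : realType) (n : nat) (x y : 'rV[R]_n) : R :=
  \sum_(j < n) x 0 j * y 0 j.

Definition is_frame (R : realType) (n N : nat) (F : 'I_N -> 'rV[R]_n) : Prop :=
  forall v : 'rV[R]_n, exists c : 'I_N -> R, v = \sum_(i < N) c i *: F i.

Definition phase_retrievable (R : realType) (n N : nat) (F : 'I_N -> 'rV[R]_n)
  : Prop :=
  forall x y : 'rV[R]_n,
    (forall i : 'I_N, `|dotv x (F i)| = `|dotv y (F i)|) -> x = y \/ x = - y.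

Definition quadf (R : realType) (n : nat) (A : 'M[R]_n) (f : 'rV[R]_n) : R :=
  \sum_(j < n) \sum_(k < n) f 0 j * A j k * f 0 k.

(* ker(Theta_{L(F_Lambda)}) ∩ S_2 : symmetric matrices of rank <= 2 with
   <A f_i, f_i> = 0 for all i in Lambda. *)
Definition kerS2 (R : realType) (n N : nat) (F : 'I_N -> 'rV[R]_n)
  (Lam : {set 'I_N}) (A : 'M[R]_n) : bool :=
  [&& A^T == A, (\rank A <= 2)%N & [forall i in Lam, quadf A (F i) == 0]].

Definition exact_PR_redundancy (R : realType) (n N : nat)
  (F : 'I_N -> 'rV[R]_n) : Prop :=
  forall Lam : {set 'I_N}, Lam \proper [set: 'I_N] ->
    ~ (kerS2 F Lam =1 kerS2 F [set: 'I_N]).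

Definition exact_PR_frame (R : realType) (n N : nat) (F : 'I_N -> 'rV[R]_n)
  : Prop :=
  [/\ is_frame F, phase_retrievable F & exact_PR_redundancy F].

(* Main.v *)
(** A real frame [F] is phase-retrievable as soon as no two nonzero vectors
    [u], [v] satisfy [<u, f_i> <v, f_i> = 0] for all [i]; and then the symmetric
    matrix [u^T v + v^T u] shows that [f_i] cannot be dropped whenever some
    nonzero [u], [v] have vanishing products off [i].

    Take the standard basis [e_1, ..., e_n] together with [M = N - n] vectors
    [c_m], each generic among the vectors of coordinate sum [0] supported on an
    edge [E_m] of a hypergraph on [n] vertices.  The basis forces [u] and [v] to
    have disjoint supports [S] and [T]; by genericity [u] kills at most
    [|S| - 1] and [v] at most [|T| - 1] of the rows whose edge meets both [S]
    and [T], so it suffices that at least [|S| + |T| - 1] edges do.  The vector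
    [e_i] is needed because of [u = (1, ..., 1)], [v = e_i].  If [E_m] has a
    vertex [i] of degree exactly [n - 1], then [c_m] is needed because of
    [u = e_i] and a [v] killing [e_i] and the [n - 2] other rows at [i].

    Hypergraphs with both properties are built one vertex at a time, adding
    either a single edge (the new vertex is put in every edge, and the edge of
    all vertices is added) or [n] edges (the new vertex is joined to each old
    one by an edge of size two); this reaches every [M] between [n - 1] and
    [n (n - 1) / 2]. *)
Require Import Defs.
From HB Require Import structures.
From mathcomp Require Import all_boot all_order all_algebra.
From mathcomp Require Import reals.
From mathcomp Require Import boolp zify ring.
Import Order.TTheory GRing.Theory Num.Theory.
Local Open Scope ring_scope.
Set Implicit Arguments. Unset Strict Implicit. Unset Printing Implicit Defensive.

(** * Wide and tight hypergraphs, and their growth by one vertex *)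

Section Hypergraphs.
Local Open Scope nat_scope.

Definition cnt (n : nat) (P : pred nat) : nat := \sum_(i < n) P i.

Definition meets (n : nat) (P Q : pred nat) : bool :=
  [exists i : 'I_n, P i && Q i].

(* A hypergraph is given by [E], where [E m i] says that vertex [i] lies on edge
   [m]; only vertices [i < n] and edges [m < M] count. *)
Definition crossing n M (E : nat -> pred nat) (S T : pred nat) : nat :=
  cnt M (fun m => meets n (E m) S && meets n (E m) T).

Definition wide_hypergraph n M (E : nat -> pred nat) : Prop :=
  forall S T : pred nat, (forall i, i < n -> ~~ (S i && T i)) ->
    0 < cnt n S -> 0 < cnt n T -> cnt n S + cnt n T <= (crossing n M E S T).+1.

Definition tight_vertex n M (E : nat -> pred nat) (i : nat) : Prop :=
  i < n /\ cnt M (E^~ i) = n.-1.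

(** The first clause matters when there are no edges: the edge of all vertices added by a cone must
    contain a tight vertex even then. *)
Definition tight_hypergraph n M (E : nat -> pred nat) : Prop :=
  (exists i, tight_vertex n M E i) /\
  forall m, m < M -> exists2 i, tight_vertex n M E i & E m i.

Lemma cntS n P : cnt n.+1 P = cnt n P + P n.
Proof. by rewrite /cnt big_ord_recr. Qed.

Lemma eq_cnt n (P Q : pred nat) : (forall i, i < n -> P i = Q i) -> cnt n P = cnt n Q.
Proof. by move=> PQ; apply: eq_bigr => i _; rewrite PQ. Qed.

Lemma leq_cnt n (P Q : pred nat) : (forall i, i < n -> P i -> Q i) -> cnt n P <= cnt n Q.
Proof.
move=> PQ; apply: leq_sum => i _.
by case: (P i) (PQ i (ltn_ord i)) => // ->.
Qed.

Lemma cnt_true n (P : pred nat) : (forall i, i < n -> P i) -> cnt n P = n.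
Proof.
move=> Pn; rewrite /cnt (eq_bigr (fun=> 1)) ?sum1_card ?card_ord // => i _.
by rewrite Pn.
Qed.

Lemma cntD m n P : cnt (m + n) P = cnt m P + cnt n (fun i => P (m + i)).
Proof. by rewrite /cnt big_split_ord. Qed.

Lemma cnt1 n k : k < n -> cnt n (fun i => i == k) = 1.
Proof.
move=> kn; rewrite /cnt (bigD1 (Ordinal kn)) //= eqxx big1 // => i.
by rewrite -val_eqE /= => /negbTE ->.
Qed.

Lemma cnt_gt0P n (P : pred nat) : reflect (exists2 i, i < n & P i) (0 < cnt n P).
Proof.
apply: (iffP idP) => [|[i ni Pi]].
  rewrite lt0n sum_nat_eq0 negb_forall => /existsP[i].
  by rewrite eqb0 negbK => Pi; exists i.
by rewrite -(cnt1 ni); apply: leq_cnt => j _ /eqP ->.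
Qed.

Lemma meetsP n (P Q : pred nat) : reflect (exists i, [/\ i < n, P i & Q i]) (meets n P Q).
Proof.
apply: (iffP existsP) => [[i /andP[Pi Qi]]|[i [ni Pi Qi]]]; first by exists i.
by exists (Ordinal ni); rewrite /= Pi.
Qed.

Lemma crossingC n M E S T : crossing n M E S T = crossing n M E T S.
Proof. by apply: eq_cnt => m _; rewrite andbC. Qed.

(** Split a vertex [t] off [T] and apply wideness to [{t}] and the rest: every edge crossing these
    two meets [T]. *)
Lemma cnt_le_degree n M E T : wide_hypergraph n M E -> 0 < cnt n T ->
  cnt n T <= (cnt M (fun m => meets n (E m) T)).+1.
Proof.
move=> wE /cnt_gt0P[t nt Tt].
pose T' i := T i && (i != t).
have cT : cnt n T = 1 + cnt n T'.
  rewrite -(cnt1 nt) /cnt -big_split /=; apply: eq_bigr => i _.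
  by rewrite /T'; case: eqP => [->|_] /=; rewrite ?Tt ?andbT.
have [T'0|T'0] := posnP (cnt n T'); first by rewrite cT T'0.
have := wE (fun i => i == t) T'; rewrite cnt1 // -cT => /(_ _ isT T'0) H.
apply: leq_trans (H _) _.
  by move=> i _; rewrite /T'; case: eqP; rewrite ?andbF.
rewrite ltnS; apply: leq_cnt => m _ /andP[_ /meetsP[i [ni Ei /andP[Ti _]]]].
by apply/meetsP; exists i.
Qed.

Definition cone_edges M (n : nat) (E : nat -> pred nat) : nat -> pred nat :=
  fun m i => [|| m == M, i == n | E m i].

(** The guard [i < n] keeps the new vertex out of the old edges, since [E] is arbitrary at [n]. *)
Definition star_edges M (n : nat) (E : nat -> pred nat) : nat -> pred nat :=
  fun m i => if m < M then (i < n) && E m i else (i == n) || (m == M + i).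

(** By disjointness and symmetry the new vertex lies in [S] or in neither set; in [S] it uses up the
    slack of one in the bound. *)
Lemma wide_hypergraph_ext n M E' :
  (forall S T : pred nat, (forall i, i <= n -> ~~ (S i && T i)) ->
    0 < cnt n.+1 S -> 0 < cnt n T -> S n ->
    cnt n S + cnt n T <= crossing n.+1 M E' S T) ->
  (forall S T : pred nat, (forall i, i < n -> ~~ (S i && T i)) ->
    0 < cnt n S -> 0 < cnt n T -> ~~ S n -> ~~ T n ->
    cnt n S + cnt n T <= (crossing n.+1 M E' S T).+1) ->
  wide_hypergraph n.+1 M E'.
Proof.
move=> Hin Hout S T dST S0 T0.
have nST := dST n (ltnSn n).
case Sn: (S n); case Tn: (T n); rewrite ?Sn ?Tn // in nST.
- move: T0; rewrite !cntS Sn Tn /= addn0 => T0.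
  by rewrite addn1 addSn ltnS; apply: Hin.
- move: S0; rewrite !cntS Sn Tn /= addn0 => S0.
  rewrite addn1 addnS ltnS addnC crossingC; apply: Hin => //.
  by move=> i ni; rewrite andbC dST.
move: S0 T0; rewrite !cntS Sn Tn !addn0 => S0 T0.
by apply: Hout; rewrite ?Sn ?Tn // => i /ltnW; apply: dST.
Qed.

Lemma wide_cone n M E : wide_hypergraph n M E ->
  wide_hypergraph n.+1 M.+1 (cone_edges M n E).
Proof.
move=> wE; apply: wide_hypergraph_ext => S T dST S0 T0 Sn.
  (* With the new vertex in [S] every edge meets [S], and the new edge meets [T] as well. *)
  have degT : (cnt M (fun m => meets n (E m) T)).+1 <=
      crossing n.+1 M.+1 (cone_edges M n E) S T.
    rewrite /crossing cntS -addn1; apply: leq_add.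
      apply: leq_cnt => m _ /meetsP[i [ni Ei Ti]].
      apply/andP; split; apply/meetsP.
        by exists n; split => //; rewrite /cone_edges eqxx orbT.
      by exists i; split; rewrite ?ltnS ?(ltnW ni) // /cone_edges Ei !orbT.
    rewrite lt0b; apply/andP; split; apply/meetsP.
      by exists n; split => //; rewrite /cone_edges eqxx.
    have /cnt_gt0P[i ni Ti] := T0.
    by exists i; split; rewrite ?ltnS ?(ltnW ni) // /cone_edges eqxx.
  apply: leq_trans degT.
  have [->|S1] := posnP (cnt n S); first exact: cnt_le_degree.
  apply: leq_trans (wE S T _ S1 T0) _; first by move=> i /ltnW; apply: dST.
  by rewrite ltnS; apply: leq_cnt => m _ /andP[].
move=> Tn; apply: leq_trans (wE S T dST S0 T0) _.
rewrite ltnS /crossing cntS; apply: leq_trans (leq_addr _ _).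
apply: leq_cnt => m _ /andP[/meetsP[i [ni Ei Si]] /meetsP[j [nj Ej Tj]]].
apply/andP; split; apply/meetsP.
  by exists i; split; rewrite ?ltnS ?(ltnW ni) // /cone_edges Ei !orbT.
by exists j; split; rewrite ?ltnS ?(ltnW nj) // /cone_edges Ej !orbT.
Qed.

(** If the new vertex is in [S], its edges to the vertices of [T] all cross. They suffice alone when
    [S] has no old vertex; otherwise, [T] being nonempty, they make up for the growth of [S]. *)
Lemma wide_star n M E : wide_hypergraph n M E ->
  wide_hypergraph n.+1 (M + n) (star_edges M n E).
Proof.
move=> wE.
have old S T : crossing n M E S T <=
    cnt M (fun m => meets n.+1 (star_edges M n E m) S &&
                    meets n.+1 (star_edges M n E m) T).
  apply: leq_cnt => m mM /andP[/meetsP[i [ni Ei Si]] /meetsP[j [nj Ej Tj]]].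
  apply/andP; split; apply/meetsP.
    by exists i; split; rewrite ?ltnS ?(ltnW ni) // /star_edges mM ni.
  by exists j; split; rewrite ?ltnS ?(ltnW nj) // /star_edges mM nj.
apply: wide_hypergraph_ext => S T dST S0 T0 Sn; last first.
  move=> _; apply: leq_trans (wE S T dST S0 T0) _.
  by rewrite ltnS /crossing cntD; apply: leq_trans (old S T) (leq_addr _ _).
rewrite /crossing cntD.
set new := (X in _ <= _ + X).
have newT : cnt n T <= new.
  rewrite /new; apply: leq_cnt => i ni Ti /=; apply/andP; split; apply/meetsP.
    by exists n; split; rewrite // /star_edges ltnNge leq_addr eqxx.
  exists i; split; rewrite ?ltnS ?(ltnW ni) // /star_edges ltnNge leq_addr /=.
  by rewrite eqxx orbT.
have := old S T.
have [->|S1] := posnP (cnt n S); first by lia.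
have := wE S T _ S1 T0; rewrite /crossing => H.
by have {}H := H (fun i ni => dST i (ltnW ni)); lia.
Qed.

(** An old vertex gains exactly the new edge, so tight vertices stay tight, and any of them serves
    the new edge. *)
Lemma tight_cone n M E : 0 < n -> tight_hypergraph n M E ->
  tight_hypergraph n.+1 M.+1 (cone_edges M n E).
Proof.
move=> n0 [[i0 ti0] tE].
have tight i : tight_vertex n M E i ->
    tight_vertex n.+1 M.+1 (cone_edges M n E) i.
  move=> [ni di]; split; first exact: ltnW.
  rewrite cntS {2}/cone_edges eqxx -[n in RHS](prednK n0) -di addn1; congr _.+1.
  by apply: eq_cnt => m mM; rewrite /cone_edges !ltn_eqF.
split=> [|m]; first by exists i0; apply: tight.
rewrite ltnS leq_eqVlt => /predU1P[->|/tE[i ti Ei]].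
  by exists i0; [apply: tight|rewrite /cone_edges eqxx].
by exists i; [apply: tight|rewrite /cone_edges Ei !orbT].
Qed.

(** The new vertex has degree [n], so it is tight and serves all new edges; each old vertex gains
    one edge. *)
Lemma tight_star n M E : 0 < n -> tight_hypergraph n M E ->
  tight_hypergraph n.+1 (M + n) (star_edges M n E).
Proof.
move=> n0 [_ tE].
have tn : tight_vertex n.+1 (M + n) (star_edges M n E) n.
  split=> //; rewrite cntD [X in X + _](eq_cnt (Q := pred0)); last first.
    by move=> m mM; rewrite /star_edges mM ltnn.
  rewrite {1}/cnt big1_eq add0n; apply: cnt_true => i _.
  by rewrite /star_edges ltnNge leq_addr eqxx.
split=> [|m]; first by exists n.
case: (ltnP m M) => [mM _|Mm _]; last first.
  by exists n; rewrite // /star_edges ltnNge Mm eqxx.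
have [i [ni di] Ei] := tE _ mM.
exists i; last by rewrite /star_edges mM ni.
split; first exact: ltnW.
rewrite cntD -[n in RHS](prednK n0) -di -addn1; congr (_ + _).
  by apply: eq_cnt => k kM; rewrite /star_edges kM ni.
rewrite -(cnt1 ni); apply: eq_cnt => k kn.
by rewrite /star_edges ltnNge leq_addr /= (ltn_eqF ni) eqn_add2l.
Qed.

Lemma exists_hypergraph n M : 0 < n -> n.-1 <= M -> M.*2 <= n * n.-1 ->
  exists E, wide_hypergraph n M E /\ tight_hypergraph n M E.
Proof.
elim: n M => // -[|n] IHn M _ leM geM.
  have -> : M = 0 by lia.
  exists (fun _ => pred0); split=> [S T dST|].
    rewrite /crossing /cnt !big_ord1 big_ord0.
    by have := dST 0 isT; case: (S 0); case: (T 0).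
  by split=> //; exists 0; split; rewrite // /cnt big_ord0.
(* Use a cone unless [M.-1] edges are too many for [n.+1] vertices; in that case [M] is so large
   that [M - n.+1] is still at least [n]. *)
have [leM1|gtM1] := leqP M.-1.*2 (n.+1 * n).
  have [E [wE tE]] := IHn M.-1 isT (ltac:(lia)) leM1.
  exists (cone_edges M.-1 n.+1 E); rewrite -{1 3}(@prednK M); last by lia.
  by split; [apply: wide_cone|apply: tight_cone].
have [E [wE tE]] := IHn (M - n.+1) isT (ltac:(nia)) (ltac:(nia)).
exists (star_edges (M - n.+1) n.+1 E).
rewrite -{1 3}(@subnK n.+1 M); last by nia.
by split; [apply: wide_star|apply: tight_star].
Qed.

End Hypergraphs.

(** * Dot products, supports and avoidance of hyperplanes *)

Section Dot.
Variables (R : realType) (n : nat).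
Implicit Types u v c d : 'rV[R]_n.

Definition supp u : {set 'I_n} := [set i | u 0 i != 0].

Lemma supp_neq0 u : (supp u != set0) = (u != 0).
Proof.
apply/set0Pn/idP => [[i]|].
  by rewrite inE; apply: contraNneq => ->; rewrite mxE.
apply: contraNP => H; apply/eqP/rowP => i; rewrite mxE.
by apply/eqP; apply: contra_notT H => ui; exists i; rewrite inE.
Qed.

Lemma dotvC u v : dotv u v = dotv v u.
Proof. by apply: eq_bigr => i _; rewrite mulrC. Qed.

Lemma dotvDr u c d e : dotv u (c + e *: d) = dotv u c + e * dotv u d.
Proof.
rewrite /dotv mulr_sumr -big_split /=; apply: eq_bigr => i _.
by rewrite !mxE; ring.
Qed.

Lemma dotv0r u : dotv u 0 = 0.
Proof. by rewrite /dotv big1 // => i _; rewrite mxE mulr0. Qed.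

Lemma dotv_delta u i : dotv u (delta_mx 0 i) = u 0 i.
Proof.
rewrite /dotv (bigD1 i) //= mxE !eqxx mulr1 big1 ?addr0 // => j ji.
by rewrite mxE (negbTE ji) andbF mulr0.
Qed.

Lemma dotv_deltaB u i j :
  dotv u (delta_mx 0 i - delta_mx 0 j) = u 0 i - u 0 j.
Proof. by rewrite -scaleN1r dotvDr !dotv_delta mulN1r. Qed.

Lemma dotv_diff_mul_sum (x y f : 'rV[R]_n) :
  dotv (x - y) f * dotv (x + y) f = dotv x f ^+ 2 - dotv y f ^+ 2.
Proof.
rewrite -[in x + y](scale1r y) -scaleN1r !(dotvC _ f) !dotvDr; ring.
Qed.

Lemma exists_notin (s : seq R) : exists e, e \notin s.
Proof.
suff [e He] : exists e, forall x, x \in s -> x < e.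
  by exists e; apply/negP => /He; rewrite ltxx.
elim: s => [|x s [e He]]; first by exists 0.
exists (Num.max (x + 1) e) => y; rewrite inE lt_max => /predU1P[->|/He ->].
  by rewrite ltrDl ltr01.
by rewrite orbT.
Qed.

(** A vector good for [us] is moved along a direction [d] not orthogonal to [u]; only finitely many
    step lengths are bad. *)
Lemma avoid_hyperplanes (L : 'rV[R]_n -> Prop) (us : seq 'rV[R]_n) :
  L 0 -> (forall c d e, L c -> L d -> L (c + e *: d)) ->
  (forall u, u \in us -> exists2 d, L d & dotv u d != 0) ->
  exists2 c, L c & forall u, u \in us -> dotv u c != 0.
Proof.
move=> L0 LD; elim: us => [|u us IH] Hus; first by exists 0.
have [|c Lc Hc] := IH; first by move=> w ws; apply: Hus; rewrite inE ws orbT.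
have [d Ld ud] := Hus u (mem_head _ _).
(* Each value is the one step that makes [w] orthogonal to the sum; if [dotv w d] is 0, the quotient
   is 0 and excluding it is harmless. *)
have [e He] := exists_notin [seq - dotv w c / dotv w d | w <- u :: us].
exists (c + e *: d) => [|w ws]; first exact: LD.
rewrite dotvDr; have [wd|wd] := eqVneq (dotv w d) 0.
  rewrite wd mulr0 addr0; move: ws; rewrite inE => /predU1P[wu|/Hc//].
  by rewrite -wu wd eqxx in ud.
apply: contraNneq He => /eqP; rewrite addrC addr_eq0 => /eqP ewd.
by apply/mapP; exists w => //; rewrite -ewd mulfK.
Qed.

Lemma exists_orthogonal (s : seq 'rV[R]_n) : (size s < n)%N ->
  exists2 v, v != 0 & forall c, c \in s -> dotv v c = 0.
Proof.
move=> sn; pose A := \matrix_(i < n, j < size s) (s`_j) 0 i.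
have K0 : kermx A != 0.
  rewrite -mxrank_eq0 mxrank_ker subn_eq0 -ltnNge.
  exact: leq_ltn_trans (rank_leq_col A) sn.
have [i Ki] : exists i, row i (kermx A) != 0.
  apply/existsP; apply: contraNT K0; rewrite negb_exists => /forallP H.
  apply/eqP/row_matrixP => i; rewrite row0; apply/eqP.
  by rewrite -[_ == _]negbK.
exists (row i (kermx A)) => // c /(nthP 0)[j js <-].
have := congr1 (fun B : 'M_(n, size s) => B i (Ordinal js)) (mulmx_ker A).
rewrite !mxE => kA; rewrite -[RHS]kA; apply: eq_bigr => k _.
by rewrite !mxE.
Qed.

End Dot.

(** * Generic zero-sum rows on the edges, and the rank bound they satisfy *)

Section Generic.
Variables (R : realType) (n M : nat) (E : 'I_M -> {set 'I_n}).
Implicit Types (C : 'I_M -> 'rV[R]_n) (Z : {set 'I_M}) (S T : {set 'I_n}).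
Implicit Types u v c d : 'rV[R]_n.

(** Such an edge carries a zero-sum vector [e_s - e_t] with [s] in [S] and [t] outside, which no [u]
    of support [S] kills. *)
Definition crosses S (m : 'I_M) : bool :=
  (E m :&: S != set0) && ~~ (E m \subset S).

Definition orth C Z u : Prop := forall z, z \in Z -> dotv u (C z) = 0.

Definition zero_sum_on S c : Prop :=
  (forall i, i \notin S -> c 0 i = 0) /\ dotv (const_mx 1) c = 0.

(* The condition on row [m] only involves the rows before it, so that generic
   rows can be chosen one after the other. *)
Definition generic_row C (m : 'I_M) : Prop :=
  forall Z u, (forall z, z \in Z -> z < m)%N -> orth C Z u ->
    crosses (supp u) m ->
    exists u', [/\ supp u' = supp u, orth C Z u' & dotv u' (C m) != 0].

Definition generic_rows C : Prop :=
  forall m, zero_sum_on (E m) (C m) /\ generic_row C m.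

Lemma exists_generic_rows : exists C, generic_rows C.
Proof.
suff H k : exists C, forall m : 'I_M, (m < k)%N ->
    zero_sum_on (E m) (C m) /\ generic_row C m.
  by have [C HC] := H M; exists C => m; apply: HC.
elim: k => [|k [C HC]]; first by exists (fun=> 0).
have [kM|Mk] := ltnP k M; last first.
  by exists C => m _; apply: HC; apply: leq_trans (ltn_ord m) Mk.
pose m0 := Ordinal kM.
(* For each [Z] and [S] it is enough to fix one [u] of support [S] orthogonal to
   the rows of [Z], which leaves finitely many hyperplanes to avoid. *)
pose P (p : {set 'I_M} * {set 'I_n}) u := supp u = p.2 /\ orth C p.1 u.
have [w Hw] : exists w, forall p u, P p u -> P p (w p).
  apply: (@fin_all_exists _ (fun=> 'rV[R]_n)
    (fun p x => forall u, P p u -> P p x)) => p.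
  have [[u Pu]|nP] := EM (exists u, P p u); first by exists u.
  by exists 0 => u Pu; case: nP; exists u.
pose us := [seq w p | p <- enum {: {set 'I_M} * {set 'I_n}} &
                      crosses (supp (w p)) m0].
have [|c d e [c0 cs] [d0 ds]||c [c0 cs] Hc] :=
    @avoid_hyperplanes R n (zero_sum_on (E m0)) us.
- by split=> [i _|]; rewrite ?mxE ?dotv0r.
- split=> [i iE|]; first by rewrite !mxE c0 // d0 // mulr0 addr0.
  by rewrite dotvDr cs ds mulr0 addr0.
- move=> u /mapP[p]; rewrite mem_filter => /andP[/andP[/set0Pn[s]]].
  rewrite inE => /andP[sE sS] /subsetPn[t tE tS] _ ->.
  exists (delta_mx 0 s - delta_mx 0 t).
    split=> [i iE|]; last by rewrite dotv_deltaB !mxE subrr.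
    rewrite !mxE eqxx /=; case: eqP iE => [->|_]; first by rewrite sE.
    by case: eqP => [->|_]; rewrite ?tE ?subrr.
  rewrite dotv_deltaB; move: sS tS; rewrite !inE negbK => sS /eqP ->.
  by rewrite subr0.
pose C' m := if m == m0 then c else C m.
have C'E (m : 'I_M) : (m < k)%N -> C' m = C m.
  by move=> mk; rewrite /C' -val_eqE /= ltn_eqF.
have orthE Z u : (forall z, z \in Z -> z < k)%N -> orth C' Z u <-> orth C Z u.
  by move=> Zk; split=> H z zZ; rewrite -(H z zZ) C'E // Zk.
exists C' => m; rewrite ltnS leq_eqVlt => /predU1P[mk|mk]; last first.
  have [mE mG] := HC m mk; split; first by rewrite C'E.
  move=> Z u Zm; have Zk z : z \in Z -> (z < k)%N by move/Zm/ltn_trans; apply.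
  move=> /(orthE _ _ Zk) /(mG _ _ Zm) H /H[u' [su' ou' u'm]].
  by exists u'; rewrite C'E //; split=> //; apply/(orthE _ _ Zk).
have -> : m = m0 by apply: val_inj.
have C'm0 : C' m0 = c by rewrite /C' eqxx.
split; first by rewrite C'm0.
move=> Z u Zk ou cu; rewrite C'm0.
have [su' ou'] : P (Z, supp u) (w (Z, supp u)).
  by apply: (Hw _ u); split=> //; apply/(orthE _ _ Zk).
exists (w (Z, supp u)); split=> //; first exact/(orthE _ _ Zk).
apply: Hc; apply/mapP; exists (Z, supp u) => //.
by rewrite mem_filter mem_enum su' cu.
Qed.

(* Each row of [Z] raises the rank of the rows of [Z] restricted to [supp u],
   since it is not orthogonal to some vector that kills the previous ones; the
   final rank is below [#|supp u|] because of [u]. *)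
Lemma card_orth_crossing C Z u : generic_rows C -> u != 0 -> orth C Z u ->
  (forall z, z \in Z -> crosses (supp u) z) -> (#|Z| < #|supp u|)%N.
Proof.
move=> gC u0 ou cZ; set S := supp u.
(* Rows outside [Y] are zeroed rather than removed, so that all these matrices share one shape. *)
pose A (Y : {set 'I_M}) :=
  \matrix_(m < M, i < #|S|) (if m \in Y then C m 0 (enum_val i) else 0).
pose r (w : 'rV[R]_n) := \col_(i < #|S|) w 0 (enum_val i).
have Ar (Y : {set 'I_M}) w m : supp w = S ->
    (A Y *m r w) m 0 = if m \in Y then dotv w (C m) else 0.
  move=> wS; rewrite mxE; case: ifP => mY; last first.
    by rewrite big1 // => i _; rewrite !mxE mY mul0r.
  rewrite /dotv (bigID (mem S)) /= [X in _ = _ + X]big1 ?addr0; last first.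
    by move=> i; rewrite -wS inE negbK => /eqP ->; rewrite mul0r.
  by rewrite [RHS]big_enum_val; apply: eq_bigr => i _; rewrite !mxE mY mulrC.
have Ar0 (Y : {set 'I_M}) w : supp w = S -> orth C Y w -> A Y *m r w = 0.
  move=> wS ow; apply/colP => m; rewrite Ar // mxE.
  by case: ifP => // /ow.
pose Y k := [set z in Z | (z < k)%N].
have rankY k : (#|Y k| <= \rank (A (Y k)))%N.
  elim: k => [|k IH].
    rewrite (_ : Y 0%N = set0) ?cards0 //.
    by apply/setP => z; rewrite !inE ltn0 andbF.
  have [/existsP[z /andP[zZ /eqP zk]]|] := boolP [exists z in Z, val z == k];
      last first.
    rewrite negb_exists => /forallP nk; suff -> : Y k.+1 = Y k by [].
    apply/setP => z; rewrite !inE ltnS leq_eqVlt.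
    by have := nk z; case: (z \in Z) => //= /negbTE ->.
  have YS : Y k.+1 = z |: Y k.
    apply/setP => y; rewrite !inE ltnS leq_eqVlt -zk val_eqE.
    by case: eqP => [->|_] //=; rewrite zZ.
  have zY : z \notin Y k by rewrite inE zk ltnn andbF.
  rewrite YS cardsU1 zY add1n; apply: leq_ltn_trans IH _; apply: rank_ltmx.
  rewrite ltmxE; apply/andP; split.
    apply/row_subP => m; have [mY|mY] := boolP (m \in Y k).
      rewrite (_ : row m _ = row m (A (z |: Y k))) ?row_sub //.
      by apply/rowP => i; rewrite !mxE mY in_setU1 mY orbT.
    rewrite (_ : row m _ = 0) ?sub0mx //.
    by apply/rowP => i; rewrite !mxE (negbTE mY).
  have [_ gz] := gC z.
  have [||u' [su' ou' /eqP u'z]] := gz (Y k) u _ _ (cZ z zZ).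
  - by move=> y; rewrite inE zk => /andP[].
  - by move=> y; rewrite inE => /andP[/ou].
  (* If the row space did not grow, [u'], which kills the rows of [Y k], would also kill row [z]. *)
  apply/negP => /submxP[D AD]; case: u'z.
  have := Ar (z |: Y k) u' z su'; rewrite setU11 AD -mulmxA Ar0 //.
  by rewrite mulmx0 mxE.
have -> : Z = Y M by apply/setP => z; rewrite inE ltn_ord andbT.
apply: leq_ltn_trans (rankY M) _; rewrite ltn_neqAle rank_leq_col andbT.
(* Full rank gives a left inverse [B], which forces [u] to vanish on its own support. *)
apply/negP => /row_fullP[B BA].
move: u0; rewrite -supp_neq0 => /set0Pn[i iS].
have ru : r u = 0.
  rewrite -[r u]mul1mx -BA -mulmxA Ar0 ?mulmx0 // => z.
  by rewrite inE => /andP[/ou].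
have := congr1 (fun x : 'cV_#|S| => x (enum_rank_in iS i) 0) ru.
by rewrite !mxE enum_rankK_in // => ui; move: iS; rewrite inE ui eqxx.
Qed.

Definition wide_edges : Prop :=
  forall S T, [disjoint S & T] -> S != set0 -> T != set0 ->
  (#|S| + #|T| <=
   #|[set m | (E m :&: S != set0) && (E m :&: T != set0)]|.+1)%N.

(** Otherwise [u] or [v] kills each row whose edge meets both supports, and the two rank bounds
    leave too few such rows for wideness. *)
Lemma generic_rows_separate C u v : wide_edges -> generic_rows C ->
  u != 0 -> v != 0 -> [disjoint supp u & supp v] -> exists m, dotv u (C m) * dotv v (C m) != 0.
Proof.
move=> wideE gC u0 v0 duv; have := wideE _ _ duv.
rewrite !supp_neq0 => /(_ u0 v0); set X := [set _ | _].
have crossX S T m : [disjoint S & T] -> E m :&: S != set0 ->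
    E m :&: T != set0 -> crosses S m.
  move=> dST ES /set0Pn[i]; rewrite inE => /andP[iE iT].
  rewrite /crosses ES; apply/subsetPn.
  by exists i => //; rewrite (disjointFl dST).
pose K w := [set m in X | dotv w (C m) == 0].
have Ku : (#|K u| < #|supp u|)%N.
  apply: (card_orth_crossing gC) => // m; rewrite !inE => /andP[/andP[Eu Ev]].
    by move/eqP.
  by move=> _; apply: crossX duv Eu Ev.
have Kv : (#|K v| < #|supp v|)%N.
  apply: (card_orth_crossing gC) => // m; rewrite !inE => /andP[/andP[Eu Ev]].
    by move/eqP.
  by move=> _; apply: crossX Ev Eu; rewrite disjoint_sym.
move=> XE; apply/existsP; apply: contraLR XE.
rewrite negb_exists => /forallP uv0.
have /subset_leq_card : X \subset K u :|: K v.
  apply/subsetP => m mX; have := uv0 m; rewrite negbK mulf_eq0.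
  by rewrite in_setU [m \in K u]inE [m \in K v]inE mX.
by have := (leq_card_setU (K u) (K v)).1; lia.
Qed.

End Generic.

(** * Transfer from hypergraphs on natural numbers to finite sets *)

Section EdgeSets.
Local Open Scope nat_scope.
Variables (n M : nat) (E : nat -> pred nat).

Definition edge_sets (m : 'I_M) : {set 'I_n} := [set i : 'I_n | E m i].

Definition nat_pred_of (S : {set 'I_n}) : pred nat :=
  fun i => if insub i is Some j then j \in S else false.

Lemma nat_pred_ofE (S : {set 'I_n}) (i : 'I_n) : nat_pred_of S i = (i \in S).
Proof. by rewrite /nat_pred_of valK. Qed.

Lemma card_cnt k (P : pred nat) : #|[set i : 'I_k | P i]| = cnt k P.
Proof.
rewrite -sum1dep_card big_mkcond /cnt; apply: eq_bigr => i _.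
by case: (P i).
Qed.

Lemma cnt_nat_pred_of S : cnt n (nat_pred_of S) = #|S|.
Proof.
by rewrite -card_cnt; apply: eq_card => i; rewrite inE nat_pred_ofE.
Qed.

Lemma meets_edge_sets (m : 'I_M) S :
  meets n (E m) (nat_pred_of S) = (edge_sets m :&: S != set0).
Proof.
apply/existsP/set0Pn => -[i]; last first.
  by rewrite !inE => iS; exists i; rewrite nat_pred_ofE.
by rewrite nat_pred_ofE => iS; exists i; rewrite !inE.
Qed.

Lemma wide_edge_sets : wide_hypergraph n M E -> wide_edges edge_sets.
Proof.
move=> wE S T dST S0 T0; rewrite -!cnt_nat_pred_of.
apply: leq_trans (wE _ _ _ _ _) _.
- move=> i ni; rewrite -[i]/(val (Ordinal ni)) !nat_pred_ofE.
  by apply/negP => /andP[iS]; rewrite (disjointFr dST).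
- by rewrite cnt_nat_pred_of card_gt0.
- by rewrite cnt_nat_pred_of card_gt0.
rewrite ltnS /crossing -card_cnt subset_leq_card //; apply/subsetP => m.
by rewrite !inE !meets_edge_sets.
Qed.

Lemma tight_edge_sets m : tight_hypergraph n M E ->
  exists2 i, i \in edge_sets m & #|[set m | i \in edge_sets m]| = n.-1.
Proof.
move=> [_ /(_ m (ltn_ord m))[i [ni di] Ei]].
exists (Ordinal ni); rewrite ?inE // -di -card_cnt.
by apply: eq_card => k; rewrite !inE.
Qed.

End EdgeSets.

(** * Criteria for phase retrieval and exactness via products of dot products *)

Section Criteria.
Variables (R : realType) (n N : nat) (F : 'I_N -> 'rV[R]_n).
Implicit Types u v : 'rV[R]_n.

Definition product_separating : Prop :=
  forall u v, u != 0 -> v != 0 -> exists i, dotv u (F i) * dotv v (F i) != 0.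

(** Equal moduli of [x] and [y] on [f] mean that [x - y] and [x + y] have vanishing product on
    [f]. *)
Lemma product_separating_PR : product_separating -> phase_retrievable F.
Proof.
move=> sF x y xy; have [xy0|xy0] := eqVneq (x - y) 0.
  by left; apply/eqP; rewrite -subr_eq0 xy0.
have [yx0|yx0] := eqVneq (x + y) 0.
  by right; apply/eqP; rewrite -addr_eq0 yx0.
have [i] := sF _ _ xy0 yx0.
by rewrite dotv_diff_mul_sum -[dotv x _ ^+ 2]real_normK ?num_real //
  xy real_normK ?num_real // subrr eqxx.
Qed.

Lemma quadf_outer u v f :
  quadf (u^T *m v + v^T *m u) f = 2 * (dotv u f * dotv v f).
Proof.
rewrite mulr2n mulrDl mul1r {2}[dotv u f * _]mulrC /dotv !big_distrlr /=.
rewrite -big_split; apply: eq_bigr => j _; rewrite -big_split.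
by apply: eq_bigr => k _; rewrite !mxE !big_ord1 !mxE /=; ring.
Qed.

Lemma rank_outer u v : (\rank (u^T *m v + v^T *m u)%R <= 2)%N.
Proof.
apply: (leq_trans (mxrank_add _ _)); apply: (@leq_add _ _ 1 1).
  exact: leq_trans (mxrankM_maxr _ _) (rank_leq_row v).
exact: leq_trans (mxrankM_maxr _ _) (rank_leq_row u).
Qed.

Lemma product_separating_exact : product_separating ->
  (forall i, exists u v, [/\ u != 0, v != 0 &
     forall j, j != i -> dotv u (F j) * dotv v (F j) = 0]) ->
  exact_PR_redundancy F.
Proof.
move=> sF mF Lam /properP[_ [i _ iLam]] kerE.
have [u [v [u0 v0 uv]]] := mF i.
have [k uvk] := sF u v u0 v0.
pose A := u^T *m v + v^T *m u.
have AT : A^T == A by rewrite /A linearD /= !trmx_mul !trmxK addrC.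
have : kerS2 F Lam A.
  rewrite /kerS2 AT rank_outer /=; apply/forall_inP => j jLam.
  rewrite quadf_outer uv ?mulr0 //.
  by apply: contraNneq iLam => <-.
rewrite kerE => /and3P[_ _ /forall_inP/(_ k (in_setT _))].
by rewrite quadf_outer mulf_eq0 pnatr_eq0 /= (negbTE uvk).
Qed.

End Criteria.

(** * The standard basis joined with the generic rows *)

Section Construction.
Variables (R : realType) (n M : nat) (E : 'I_M -> {set 'I_n}).
Variable C : 'I_M -> 'rV[R]_n.

Definition basis_and_rows (k : 'I_(n + M)) : 'rV[R]_n :=
  match split k with inl i => delta_mx 0 i | inr m => C m end.

Lemma basis_and_rows_l i : basis_and_rows (lshift M i) = delta_mx 0 i.
Proof. by rewrite /basis_and_rows (unsplitK (inl i)). Qed.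

Lemma basis_and_rows_r m : basis_and_rows (rshift n m) = C m.
Proof. by rewrite /basis_and_rows (unsplitK (inr m)). Qed.

Lemma basis_and_rows_frame : is_frame basis_and_rows.
Proof.
move=> v; exists (fun k => if split k is inl i then v 0 i else 0).
rewrite big_split_ord /= [X in _ + X]big1 ?addr0 => [|m _]; last first.
  by rewrite (unsplitK (inr m)) scale0r.
rewrite {1}[v]row_sum_delta; apply: eq_bigr => i _.
by rewrite basis_and_rows_l (unsplitK (inl i)).
Qed.

(** A basis vector separates overlapping supports, a generic row disjoint ones. *)
Lemma basis_and_rows_separating : wide_edges E -> generic_rows E C ->
  product_separating basis_and_rows.
Proof.
move=> wideE gC u v u0 v0; have [duv|/pred0Pn[i /andP[]]] :=
    boolP [disjoint supp u & supp v].
  have [m uvm] := generic_rows_separate wideE gC u0 v0 duv.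
  by exists (rshift n m); rewrite basis_and_rows_r.
rewrite /= !inE => ui vi; exists (lshift M i).
by rewrite basis_and_rows_l !dotv_delta mulf_neq0.
Qed.

Lemma basis_and_rows_minimal : generic_rows E C ->
  (forall m, exists2 i, i \in E m & #|[set m | i \in E m]| = n.-1) ->
  forall k, exists u v, [/\ u != 0, v != 0 & forall j, j != k ->
    dotv u (basis_and_rows j) * dotv v (basis_and_rows j) = 0].
Proof.
move=> gC tE k.
have delta_neq0 i : delta_mx 0 i != 0 :> 'rV[R]_n.
  by apply/eqP => /rowP/(_ i)/eqP; rewrite !mxE !eqxx oner_eq0.
case: (split_ordP k) => [i ->|m ->].
  exists (const_mx 1), (delta_mx 0 i); split=> //.
    by apply/eqP => /rowP/(_ i)/eqP; rewrite !mxE oner_eq0.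
  move=> j; case: (split_ordP j) => [l ->|m ->] jk; last first.
    by rewrite basis_and_rows_r (gC m).1.2 mul0r.
  rewrite basis_and_rows_l !dotv_delta !mxE eqxx /=.
  by rewrite (inj_eq (@lshift_inj _ _)) in jk; rewrite (negbTE jk) mulr0.
have [i iE di] := tE m; pose D := [set m | i \in E m].
(* Tightness leaves [n - 2] other rows at [i]; with [delta_mx 0 i] this makes [n - 1] conditions on
   [v]. *)
have [|v v0 vD] := @exists_orthogonal R n
    (delta_mx 0 i :: [seq C l | l <- enum (D :\ m)]).
  rewrite /= size_map -cardE; have := cardsD1 m D.
  by rewrite di inE iE; have := ltn_ord i; lia.
exists (delta_mx 0 i), v; split=> // j.
case: (split_ordP j) => [l -> _|l -> lm].
  rewrite basis_and_rows_l !dotv_delta mxE eqxx /=.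
  case: eqP => [->|_]; last by rewrite mul0r.
  by rewrite -dotv_delta vD ?mulr0 ?mem_head.
rewrite (inj_eq (@rshift_inj _ _)) in lm; rewrite basis_and_rows_r.
have [iEl|iEl] := boolP (i \in E l).
  rewrite (vD (C l)) ?mulr0 // inE; apply/orP; right; apply: map_f.
  by rewrite mem_enum !inE lm.
by rewrite dotvC dotv_delta (gC l).1.1 ?mul0r.
Qed.

End Construction.

(** * Assembly of the frame from a hypergraph with [N - n] edges *)

Theorem theorem2p1 (R : realType) (n N : nat) :
  (1 <= n)%N -> (2 * n - 1 <= N)%N -> (N <= n * (n + 1) %/ 2)%N ->
  exists F : 'I_N -> 'rV[R]_n, exact_PR_frame F.
Proof.
move=> n1 leN geN.
have NE : N = (n + (N - n))%N by lia.
(* Doubling clears the integer division in the upper bound on [N]. *)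
have geM : ((N - n).*2 <= n * n.-1)%N.
  have : (N * 2 <= n * (n + 1))%N.
    exact: leq_trans (leq_mul geN (leqnn 2)) (leq_trunc_div _ _).
  by nia.
have [|E [wE tE]] := exists_hypergraph n1 _ geM; first by lia.
rewrite NE.
pose Es := @edge_sets n (N - n) E.
have [C gC] := exists_generic_rows R Es.
have wEs : wide_edges Es := wide_edge_sets wE.
have sF := basis_and_rows_separating wEs gC.
exists (basis_and_rows C); split; first exact: basis_and_rows_frame.
  exact: product_separating_PR.
apply: product_separating_exact => //.
by apply: (basis_and_rows_minimal gC) => m; apply: tight_edge_sets.
Qed.
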